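(* Let $d\in\{2,3\}$, let $\lambda,\mu,\rho,\omega>0$ be real constants, let $h_1,\dots,h_d>0$ be mesh sizes, and set $k_S=\omega\sqrt{\rho/\mu}$ and $k_P=\omega\sqrt{\rho/(\lambda+2\mu)}$. Let $\sigma_h(\xi)\in\mathbb{C}^{d\times d}$ be the symbol of the MAC discretization of the isotropic elastic Helmholtz operator, $$\sigma_h(\xi)=-\mu\,\sigma_{\Delta_h}(\xi)I_d-(\lambda+\mu)\,\sigma_{\nabla_h}(\xi)\,\sigma_{\mathrm{div}_h}(\xi)-\rho\omega^2I_d,\qquad \xi\in\mathbb{R}^d,$$ with $\sigma_{\nabla_h},\sigma_{\mathrm{div}_h},\sigma_{\Delta_h}$ as defined in the context. Then the discrete dispersion relation $D_h=\{\xi\in\mathbb{R}^d:\det\sigma_h(\xi)=0\}$ satisfies $$D_h=\left\{\xi\in\mathbb{R}^d:\left(-\sigma_{\Delta_h}(\xi)-\omega^2\frac{\rho}{\mu}\right)^{d-1}\left(-\sigma_{\Delta_h}(\xi)-\omega^2\frac{\rho}{\lambda+2\mu}\right)=0\right\},$$ that is, $$D_h=\left\{\xi\in\mathbb{R}^d:-\sigma_{\Delta_h}(\xi)-k_S^2=0\right\}\cup\left\{\xi\in\mathbb{R}^d:-\sigma_{\Delta_h}(\xi)-k_P^2=0\right\}.$$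
   Context: For $\xi=(\xi_1,\dots,\xi_d)\in\mathbb{R}^d$ and $j=1,\dots,d$, the symbols of the forward and backward difference operators in direction $j$ are $$\sigma_{\delta_j^+}(\xi)=\frac{e^{\mathrm{i}\xi_jh_j}-1}{h_j},\qquad \sigma_{\delta_j^-}(\xi)=\frac{1-e^{-\mathrm{i}\xi_jh_j}}{h_j}.$$ The symbol of the discrete gradient is the column vector $\sigma_{\nabla_h}(\xi)=(\sigma_{\delta_1^-}(\xi),\dots,\sigma_{\delta_d^-}(\xi))^T$. The symbol of the discrete divergence is the row vector $\sigma_{\mathrm{div}_h}(\xi)=(\sigma_{\delta_1^+}(\xi),\dots,\sigma_{\delta_d^+}(\xi))$. The symbol of the discrete scalar Laplacian is the scalar $\sigma_{\Delta_h}(\xi)=\sigma_{\mathrm{div}_h}(\xi)\sigma_{\nabla_h}(\xi)$. $I_d$ is the $d\times d$ identity matrix. *)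

(* Defs.v *)
From mathcomp Require Import all_boot all_order all_algebra.
From mathcomp Require Import all_classical all_reals all_analysis.
From mathcomp Require Export complex.

Set Implicit Arguments.
Unset Strict Implicit.
Unset Printing Implicit Defensive.

Import Order.TTheory GRing.Theory Num.Theory.
Local Open Scope ring_scope.
Local Open Scope complex_scope.

(* Complex exponential: e^(x + i y) = e^x (cos y + i sin y). *)
Definition cexp (R : realType) (z : R[i]) : R[i] :=
  let: x +i* y := z in (expR x)%:C * (cos y +i* sin y).

Definition symb_fwd (R : realType) (d : nat) (h xi : 'rV[R]_d) (j : 'I_d) :
    R[i] :=
  (cexp ('i%C * (xi 0 j * h 0 j)%:C) - 1) / (h 0 j)%:C.

Definition symb_bwd (R : realType) (d : nat) (h xi : 'rV[R]_d) (j : 'I_d) :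
    R[i] :=
  (1 - cexp (- ('i%C * (xi 0 j * h 0 j)%:C))) / (h 0 j)%:C.

Definition symb_grad (R : realType) (d : nat) (h xi : 'rV[R]_d) : 'cV[R[i]]_d :=
  \col_(j < d) symb_bwd h xi j.

Definition symb_div (R : realType) (d : nat) (h xi : 'rV[R]_d) : 'rV[R[i]]_d :=
  \row_(j < d) symb_fwd h xi j.

(* The 1 x 1 matrix product div * grad, read as a scalar. *)
Definition symb_lap (R : realType) (d : nat) (h xi : 'rV[R]_d) : R[i] :=
  (symb_div h xi *m symb_grad h xi) 0 0.

Definition symb_elastic (R : realType) (d : nat) (lambda mu rho omega : R)
    (h xi : 'rV[R]_d) : 'M[R[i]]_d :=
  - (mu%:C * symb_lap h xi) *: 1%:M
  - (lambda + mu)%:C *: (symb_grad h xi *m symb_div h xi)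
  - (rho * omega ^+ 2)%:C *: 1%:M.

Definition dispersion_set (R : realType) (d : nat) (lambda mu rho omega : R)
    (h : 'rV[R]_d) : set 'rV[R]_d :=
  [set xi | \det (symb_elastic lambda mu rho omega h xi) = 0]%classic.

Definition wavenumber_S (R : realType) (mu rho omega : R) : R :=
  omega * Num.sqrt (rho / mu).

Definition wavenumber_P (R : realType) (lambda mu rho omega : R) : R :=
  omega * Num.sqrt (rho / (lambda + 2 * mu)).

(* Main.v *)
Require Import Defs.
From mathcomp Require Import all_boot all_order all_algebra.
From mathcomp Require Import all_classical all_reals all_analysis.
From mathcomp Require Import complex.
From mathcomp Require Import ring.

Import Order.TTheory GRing.Theory Num.Theory.
Local Open Scope classical_set_scope.
Local Open Scope ring_scope.
Local Open Scope complex_scope.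

(** The symbol is a scalar matrix plus a rank-one matrix: with [L] the Laplacian symbol and
    [a = -mu L - rho omega^2], it is [a I - (lambda + mu) grad div]. By the matrix determinant lemma
    ([det_scalar_add_rank1]) and [div grad = L], its determinant is [a^(d-1)] (shear) times [a -
    (lambda + mu) L = -(lambda + 2 mu) L - rho omega^2] (pressure). Pulling out the nonzero
    constants [mu] and [lambda + 2 mu] leaves the two discrete Helmholtz symbols. *)

(** The second elimination multiplies by a block matrix of determinant [a], so it gives the identity
    only up to a factor [a]; regularity cancels it. *)
Lemma det_scalar_add_rank1_lreg (R : comNzRingType) (n : nat) (a : R)
    (u : 'cV[R]_n.+1) (v : 'rV[R]_n.+1) : GRing.lreg a ->
  \det (a%:M + u *m v) = a ^+ n * (a + (v *m u) 0 0).
Proof.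
move=> areg; apply: (areg).
(* Two eliminations of the bordered matrix [[1, -v], [u, a]]. *)
pose M := block_mx (1%:M : 'M[R]_1) (- v) u a%:M.
have detM : \det M = \det (a%:M + u *m v).
  have -> : M = block_mx 1%:M 0 u 1%:M *m block_mx 1%:M (- v) 0 (a%:M + u *m v).
    rewrite mulmx_block !mul0mx !mul1mx !mulmx1 mulmxN !addr0.
    by rewrite addrCA addNr addr0.
  by rewrite det_mulmx det_lblock det_ublock !det1 !mul1r.
have -> : a * \det (a%:M + u *m v) =
    \det (M *m block_mx a%:M 0 (- u) 1%:M).
  by rewrite det_mulmx detM det_lblock det1 mulr1 det_scalar1 mulrC.
rewrite mulmx_block !mulmx0 !mul1mx !mulmx1 add0r mulNmx mulmxN opprK.
rewrite mul_mx_scalar mulmxN mul_scalar_mx subrr !add0r.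
rewrite det_ublock det_scalar det_mx11 !mxE eqxx mulr1n exprS.
by rewrite mulrC mulrA.
Qed.

(* A non-regular [a] is handled by evaluating at 0 the identity for ['X + a],
   which is monic, hence regular. *)
Lemma det_scalar_add_rank1 (R : comNzRingType) (n : nat) (a : R)
    (u : 'cV[R]_n.+1) (v : 'rV[R]_n.+1) :
  \det (a%:M + u *m v) = a ^+ n * (a + (v *m u) 0 0).
Proof.
have Xareg : GRing.lreg ('X + a%:P).
  by apply: monic_lreg; rewrite monicXaddC.
have polyCK k l (A : 'M[R]_(k, l)) :
    map_mx (horner_eval 0) (map_mx polyC A) = A.
  by apply/matrixP => i j; rewrite !mxE /horner_eval hornerC.
have /(congr1 (horner_eval 0)) := det_scalar_add_rank1_lreg _ _ _
  (map_mx polyC u) (map_mx polyC v) Xareg.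
rewrite -!map_mxM [in RHS]mxE -det_map_mx map_mxD map_scalar_mx polyCK.
by rewrite /= /horner_eval !hornerE.
Qed.

Lemma det_symb_elastic (R : realType) (n : nat) (lambda mu rho omega : R)
    (h xi : 'rV[R]_n.+1) : mu != 0 -> lambda + 2 * mu != 0 ->
  \det (symb_elastic lambda mu rho omega h xi) =
    (mu ^+ n * (lambda + 2 * mu))%:C *
    ((- symb_lap h xi - (omega ^+ 2 * (rho / mu))%:C) ^+ n
     * (- symb_lap h xi - (omega ^+ 2 * (rho / (lambda + 2 * mu)))%:C)).
Proof.
move=> mu0 lmu0; set L := symb_lap h xi.
pose a := - (mu%:C * L) - (rho * omega ^+ 2)%:C.
have -> : symb_elastic lambda mu rho omega h xi =
    a%:M + (- (lambda + mu)%:C *: symb_grad h xi) *m symb_div h xi.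
  rewrite /symb_elastic -/L -scalemxAl -[a%:M]scalemx1 scalerBl !scaleNr.
  by rewrite addrAC.
rewrite det_scalar_add_rank1 -scalemxAr mxE -/(symb_lap h xi) -/L.
have -> : a = mu%:C * (- L - (omega ^+ 2 * (rho / mu))%:C).
  rewrite /a (_ : rho * omega ^+ 2 = mu * (omega ^+ 2 * (rho / mu))).
    by rewrite rmorphM mulrBr mulrN.
  by field.
(* Both sides are [rho omega^2]; this lets the mass term factor through [lambda + 2 mu] instead of
   [mu]. *)
have e : mu * (omega ^+ 2 * (rho / mu)) =
    (lambda + 2 * mu) * (omega ^+ 2 * (rho / (lambda + 2 * mu))).
  by field; rewrite mu0 lmu0.
have -> : mu%:C * (- L - (omega ^+ 2 * (rho / mu))%:C) + - (lambda + mu)%:C * L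
    = (lambda + 2 * mu)%:C *
      (- L - (omega ^+ 2 * (rho / (lambda + 2 * mu)))%:C).
  rewrite !mulrBr -!rmorphM e.
  rewrite addrAC; congr (_ - _).
  by rewrite !rmorphD rmorphM rmorph_nat /=; ring.
by rewrite exprMn mulrACA -rmorphXn -rmorphM.
Qed.

Theorem mainTheorem2 (R : realType) (d : nat) (hd : d = 2%N \/ d = 3%N)
    (lambda mu rho omega : R) (hlambda : 0 < lambda) (hmu : 0 < mu)
    (hrho : 0 < rho) (homega : 0 < omega)
    (h : 'rV[R]_d) (hh : forall j : 'I_d, 0 < h 0 j) :
  dispersion_set lambda mu rho omega h =
    [set xi : 'rV[R]_d |
      (- symb_lap h xi - (omega ^+ 2 * (rho / mu))%:C) ^+ (d - 1)
      * (- symb_lap h xi - (omega ^+ 2 * (rho / (lambda + 2 * mu)))%:C) = 0]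
  /\
  dispersion_set lambda mu rho omega h =
    [set xi : 'rV[R]_d |
      - symb_lap h xi - ((wavenumber_S mu rho omega) ^+ 2)%:C = 0]
    `|`
    [set xi : 'rV[R]_d |
      - symb_lap h xi - ((wavenumber_P lambda mu rho omega) ^+ 2)%:C = 0].
Proof.
have mu0 : mu != 0 by rewrite gt_eqF.
have lmu : 0 < lambda + 2 * mu by rewrite addr_gt0 ?mulr_gt0.
have lmu0 : lambda + 2 * mu != 0 by rewrite gt_eqF.
have dgt1 : (1 < d)%N by case: hd => ->.
(* Write [d = n + 1]; [n0] then says that the shear exponent [n] is positive. *)
case: d hd h hh dgt1 => [//|n] _ {}h _ n0; rewrite subn1 /=.
have kS : wavenumber_S mu rho omega ^+ 2 = omega ^+ 2 * (rho / mu).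
  by rewrite exprMn sqr_sqrtr // divr_ge0 ?ltW.
have kP : wavenumber_P lambda mu rho omega ^+ 2 =
    omega ^+ 2 * (rho / (lambda + 2 * mu)).
  by rewrite exprMn sqr_sqrtr // divr_ge0 ?ltW.
have c0 : (mu ^+ n * (lambda + 2 * mu))%:C != 0 :> R[i].
  by rewrite fmorph_eq0 mulf_neq0 ?expf_neq0.
rewrite kS kP; split; apply/seteqP; split=> xi;
  rewrite /dispersion_set /= det_symb_elastic //.
- by move/eqP; rewrite mulf_eq0 (negPf c0) => /eqP.
- by move=> ->; rewrite mulr0.
- move/eqP; rewrite mulf_eq0 (negPf c0) /= mulf_eq0 expf_eq0.
  by case/orP => [/andP[_]|] /eqP; [left | right].
(* A shear root kills the product because [0 ^+ n = 0], which would fail for [n = 0]. *)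
- by case=> ->; rewrite ?mulr0 // expr0n gtn_eqF // mul0r mulr0.
Qed.
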